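(* Let $(H,\langle\cdot,\cdot\rangle)$ be a real or complex Hilbert space with scalar field $\mathbb{K}$. If $P:H\to\mathbb{K}$ is a continuous polynomial of degree $n$ and $x$ is a unit vector in $H$, then \[ \{\,n^{2}|P(x)|^{2}-|DP(x)x|^{2}+\|DP(x)\|^{2}\,\}^{1/2}\le n\|P\|. \] In particular, if $P=\widehat{L}$ is a continuous $n$-homogeneous polynomial on $H$, then \[ \|D\widehat{L}\|\le n\|\widehat{L}\|. \] In other words, $\|L\|=\|\widehat{L}\|$ for every continuous symmetric $n$-linear form $L:H^n\to\mathbb{K}$.
   Context: For a Banach space $X$ over $\mathbb{K}$, a continuous $k$-homogeneous polynomial on $X$ is a map $\widehat{L}:X\to\mathbb{K}$ of the form $\widehat{L}(x)=L(x,\dots,x)$, where $L:X^k\to\mathbb{K}$ is a continuous symmetric $k$-linear form (uniquely determined by $\widehat{L}$). A continuous polynomial of degree at most $n$ is $P=P_0+P_1+\cdots+P_n$ with $P_0$ constant and each $P_k$ a continuous $k$-homogeneous polynomial. Here $n\ge 1$. Norms: $\|P\|=\sup\{|P(x)|:\|x\|\le 1\}$ and $\|L\|=\sup\{|L(x_1,\dots,x_n)|:\|x_i\|\le 1\}$. $DP(x)$ is the (first) Fréchet derivative of $P$ at $x$, a continuous linear functional on $X$ with $\|DP(x)\|=\sup_{\|y\|\le1}|DP(x)y|$, and $\|DP\|=\sup_{\|x\|\le 1}\|DP(x)\|$. *)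

(* Defs.v *)
(* MathComp and MathComp-Analysis, with real-closed for R[i]. *)
From mathcomp Require Import all_boot all_order all_algebra all_fingroup.
From mathcomp Require Import sesquilinear complex.
From mathcomp Require Import boolp classical_sets reals topology normedtype.
From mathcomp Require Import landau derive.

Set Implicit Arguments.
Unset Strict Implicit.
Unset Printing Implicit Defensive.

Import Order.TTheory GRing.Theory Num.Theory.
Import numFieldNormedType.Exports.

Local Open Scope classical_set_scope.
Local Open Scope ring_scope.

Variant scalars := RealScalars | ComplexScalars.

Definition scalar_field (R : realType) (s : scalars) : numFieldType :=
  match s with RealScalars => R | ComplexScalars => R[i] end.

Definition scalar_conj (R : realType) (s : scalars) :
    scalar_field R s -> scalar_field R s :=
  match s with RealScalars => idfun | ComplexScalars => Num.conj end.

(* On a numFieldType the norm [`|z|] takes its values in the field itself;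
   [modulus] reads it as an element of [R], where suprema are available. *)
Definition modulus (R : realType) (s : scalars) : scalar_field R s -> R :=
  match s with
  | RealScalars => fun z => `|z|
  | ComplexScalars => fun z => complex.Re `|z|
  end.

Section polynomials.
Context {R : realType} {s : scalars}.
Local Notation K := (scalar_field R s).
Context {X : normedModType K}.

(* A [k]-tuple of vectors is a row [v : 'rV[X]_k], whose topology is the
   product topology of X^k. *)
Definition replace_coord k (v : 'rV[X]_k) (i : 'I_k) (u : X) : 'rV[X]_k :=
  \row_j (if j == i then u else v 0 j).

Definition multilinear_form k (L : 'rV[X]_k -> K^o) : Prop :=
  forall (v : 'rV[X]_k) (i : 'I_k), scalar (fun u => L (replace_coord v i u)).

Definition symmetric_form k (L : 'rV[X]_k -> K^o) : Prop :=
  forall (p : 'S_k) (v : 'rV[X]_k), L (col_perm p v) = L v.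

Definition continuous_symmetric_form k (L : 'rV[X]_k -> K^o) : Prop :=
  [/\ continuous L, symmetric_form L & multilinear_form L].

Definition associated_poly k (L : 'rV[X]_k -> K^o) : X -> K^o :=
  fun x => L (const_mx x).

Definition continuous_homogeneous_poly k (P : X -> K^o) : Prop :=
  exists2 L : 'rV[X]_k -> K^o,
    continuous_symmetric_form L & P = associated_poly L.

(* Degree at most [n]. The term of index 0 is a constant, because 'rV[X]_0 has
   exactly one element. *)
Definition continuous_poly n (P : X -> K^o) : Prop :=
  exists2 Q : 'I_n.+1 -> X -> K^o,
    forall k : 'I_n.+1, continuous_homogeneous_poly k (Q k) &
    forall x, P x = \sum_(k < n.+1) Q k x.

(* Applied to a continuous linear functional, this is its dual norm. The
   suprema below are real-valued, hence 0 by convention for an unbounded set;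
   all of them are bounded for continuous polynomials and forms. *)
Definition sup_norm (P : X -> K^o) : R :=
  sup [set modulus (P x) | x in [set x : X | `|x| <= 1]].

Definition form_norm k (L : 'rV[X]_k -> K^o) : R :=
  sup [set modulus (L v) | v in
    [set v : 'rV[X]_k | forall i : 'I_k, `|v 0 i| <= 1]].

Definition diff_norm (P : X -> K^o) : R :=
  sup [set sup_norm ('d P x) | x in [set x : X | `|x| <= 1]].

End polynomials.

(* Main.v *)
(** Let [x], [y] be orthogonal vectors in the unit ball, [x] of norm 1. With
    [z = c + i d] on the unit circle, [z^n P(c x + d y)] is the restriction to
    the circle of a complex polynomial [q] of degree at most [2n], bounded there
    by [||P||], with [q(1) = P(x)] and [q'(1) = n P(x) - i DP(x)y].
    If [|q| <= M] on the circle and [deg q <= N], then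
    [|N q(1) - (1 - w) q'(1)| <= N M] for [|w| = 1]: on the solutions of
    [z^N = w], the average of [z^j |1 + z + ... + z^(N-1)|^2] is
    [N - j (1 - w)] for [0 <= j <= N], so the quantity to bound is the average
    of [q] against a positive kernel of total mass [N].
    For [N = 2n] and [w = (c + i d)^2] this reads
    [|n c P(x) + d DP(x)y| <= n ||P||] whenever [c^2 + d^2 = 1]; multiplying [y]
    by a scalar of modulus 1 aligns the two phases, which gives
    [n^2 |P(x)|^2 + |DP(x)y|^2 <= n^2 ||P||^2]. A general direction is an
    orthogonal combination of [x] and such a [y].
    For [P] homogeneous, [DP(x)x = n P(x)] bounds [DP(x)] by [n ||P||] on the
    sphere, hence on the ball; since [DP(x)y = n L(x, ..., x, y)], fixing one
    argument at a time yields [||L|| <= ||P||]. *)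
Require Import Defs.
From HB Require Import structures.
From mathcomp Require Import all_boot all_order all_algebra all_fingroup.
From mathcomp Require Import all_solvable all_field.
From mathcomp Require Import sesquilinear complex ring.
From mathcomp Require Import lra.
From mathcomp Require Import boolp classical_sets reals topology normedtype.
From mathcomp Require Import landau derive.

Set Implicit Arguments.
Unset Strict Implicit.
Unset Printing Implicit Defensive.

Import Order.TTheory GRing.Theory Num.Theory.
Import numFieldNormedType.Exports.

Local Open Scope ring_scope.

(** * Averages over the solutions of [z ^+ n = w] and a polar derivative bound *)

Section Interpolation.
Variable C : numClosedFieldType.
Implicit Types (z w : C) (q : {poly C}).

(** ['X^n - 1] splits over [C] and is separable in characteristic zero; its [n] distinct roots must
    include a primitive one. *)
Lemma prim_root_exists n : (0 < n)%N -> exists z : C, n.-primitive_root z.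
Proof.
move=> n_gt0; pose p : {poly C} := 'X^n - 1.
have [r Dp] := closed_field_poly_normal p.
rewrite (monicP _) ?monicXnsubC // scale1r in Dp.
have rn1 : all n.-unity_root r.
  by apply/allP => z; rewrite -root_prod_XsubC -Dp.
have sz_r : (n < (size r).+1)%N.
  by rewrite -(size_prod_XsubC r id) -Dp size_XnsubC.
have [|z] := hasP (has_prim_root n_gt0 rn1 _ sz_r); last by exists z.
by rewrite -separable_prod_XsubC -Dp separable_Xn_sub_1 // pnatr_eq0 -lt0n.
Qed.

Lemma norm1_inv z : `|z| = 1 -> z * z^* = 1.
Proof. by move=> z1; rewrite -normCK z1 expr1n. Qed.

(** The points are one [n]-th root of [w] times all the [n]-th roots of unity. The sum over [k] is
    then geometric, with ratio 1 only for [j = m]. *)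
Lemma root_system_orthogonal n w : (0 < n)%N -> `|w| = 1 ->
  exists z : 'I_n -> C, [/\ forall k, `|z k| = 1, forall k, z k ^+ n = w &
    forall j m : 'I_n, \sum_k z k ^+ j * (z k)^* ^+ m = n%:R *+ (j == m)].
Proof.
move=> n_gt0 w1; have [zeta zetaP] := prim_root_exists n_gt0.
have expr_norm1 z : `|z ^+ n| = 1 -> `|z| = 1.
  by move/eqP; rewrite normrX pexpr_eq1 // => /eqP.
have zeta_norm1 : `|zeta| = 1.
  by apply: expr_norm1; rewrite (prim_expr_order zetaP) normr1.
have v_norm1 : `|n.-root w| = 1 by apply: expr_norm1; rewrite rootCK.
exists (fun k => n.-root w * zeta ^+ k); split => [k|k|j m].
- by rewrite normrM normrX v_norm1 zeta_norm1 expr1n mulr1.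
- by rewrite exprMn rootCK // exprAC (prim_expr_order zetaP) expr1n mulr1.
pose r := zeta ^+ j * zeta^* ^+ m.
have termE (k : 'I_n) : (n.-root w * zeta ^+ k) ^+ j *
    (n.-root w * zeta ^+ k)^* ^+ m =
    n.-root w ^+ j * (n.-root w)^* ^+ m * r ^+ k.
  rewrite rmorphM rmorphXn /r !exprMn -!exprM ![(k * _)%N]mulnC !exprM /=.
  by rewrite mulrACA.
rewrite (eq_bigr _ (fun k _ => termE k)) -mulr_sumr.
have [eq_jm|neq_jm] := eqVneq j m.
  have -> : r = 1 by rewrite /r eq_jm -exprMn norm1_inv // expr1n.
  rewrite eq_jm -exprMn norm1_inv // expr1n mul1r.
  under eq_bigr => k _ do rewrite expr1n.
  by rewrite big_const_ord iter_addr_0.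
rewrite mulr0n; apply/eqP; rewrite mulf_eq0; apply/orP; right.
have r_neq1 : r - 1 != 0.
  apply: contra neq_jm; rewrite subr_eq0 => /eqP r1.
  rewrite -[j == m]/(j == m :> nat) -(modn_small (ltn_ord j)).
  rewrite -{1}(modn_small (ltn_ord m)) -(eq_prim_root_expr zetaP).
  rewrite -[X in _ == X]mul1r -r1 /r -mulrA -exprMn [zeta^* * _]mulrC.
  by rewrite norm1_inv // expr1n mulr1.
(* Multiplication by [r - 1] turns the sum into [r ^+ n - 1], which is 0. *)
rewrite -(mulrI_eq0 _ (mulfI r_neq1)) -subrX1 subr_eq0.
rewrite /r exprMn -!exprM ![(_ * n)%N]mulnC !exprM -rmorphXn /=.
by rewrite (prim_expr_order zetaP) rmorph1 !expr1n mulr1.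
Qed.

(** Multiplying by [1 - z] telescopes one of the two factors of
    [|1 + z + ... + z^(n-1)|^2], so that consecutive moments differ by
    [n (1 - w)] by orthogonality. *)
Lemma fejer_moments n w (z : 'I_n -> C) : (forall k, `|z k| = 1) ->
  (forall k, z k ^+ n = w) ->
  (forall j m : 'I_n, \sum_k z k ^+ j * (z k)^* ^+ m = n%:R *+ (j == m)) ->
  forall j, (j <= n)%N ->
  \sum_k z k ^+ j * `|\sum_(l < n) z k ^+ l| ^+ 2 =
    n%:R * (n%:R - j%:R * (1 - w)).
Proof.
move=> z1 zw orth; elim=> [|j IHj] j_le.
  transitivity (\sum_(k < n) \sum_(l < n) \sum_(m < n) z k ^+ l * (z k)^* ^+ m).
    apply: eq_bigr => k _; rewrite expr0 mul1r normCK rmorph_sum mulr_suml.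
    apply: eq_bigr => l _; rewrite mulr_sumr.
    by apply: eq_bigr => m _; rewrite rmorphXn.
  rewrite exchange_big /= (eq_bigr (fun=> n%:R)) => [|l _].
    by rewrite big_const_ord iter_addr_0 mul0r subr0 mulr_natr.
  rewrite exchange_big /= (bigD1 l) //= orth eqxx mulr1n big1 ?addr0 // => m.
  by rewrite orth eq_sym => /negPf->.
have -> : n%:R * (n%:R - j.+1%:R * (1 - w)) =
    n%:R * (n%:R - j%:R * (1 - w)) - n%:R * (1 - w) :> C.
  by rewrite -mulrBr -natr1 mulrDl mul1r opprD addrA.
rewrite -IHj 1?ltnW //.
(* By orthogonality only the term [m = j] survives the sum over [k]; such an [m] exists because
   [j < n]. *)
have -> : n%:R * (1 - w) =
    \sum_k \sum_(m < n) z k ^+ j * (z k)^* ^+ m * (1 - w).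
  rewrite exchange_big /= (bigD1 (Ordinal j_le)) //= -mulr_suml.
  rewrite (orth (Ordinal j_le) (Ordinal j_le)) eqxx mulr1n.
  rewrite big1 ?addr0 // => m neq_mj.
  by rewrite -mulr_suml (orth (Ordinal j_le)) eq_sym (negPf neq_mj) mul0r.
rewrite -sumrB; apply: eq_bigr => k _.
rewrite -mulr_suml -mulr_sumr -(zw k) normCK.
have -> : \sum_(m < n) (z k)^* ^+ m = (\sum_(l < n) z k ^+ l)^*.
  by rewrite rmorph_sum; apply: eq_bigr => m _; rewrite rmorphXn.
by rewrite -[1 - _]opprB subrX1 exprSr; ring.
Qed.

(** The quantity under the norm is the polar derivative of [q] with pole [w], taken at 1. It is
    linear in [q], so the moments of the monomials write it as an average of [q] with nonnegative
    weights. *)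
Lemma polar_derivative_bound n q w M : (0 < n)%N -> (size q <= n.+1)%N ->
  `|w| = 1 -> (forall z, `|z| = 1 -> `|q.[z]| <= M) ->
  `|n%:R * q.[1] - (1 - w) * q^`().[1]| <= n%:R * M.
Proof.
move=> n_gt0 sz_q w1 q_le.
have [z [z1 zw orth]] := root_system_orthogonal n_gt0 w1.
have moments := fejer_moments z1 zw orth.
have n_neq0 : n%:R != 0 :> C by rewrite pnatr_eq0 -lt0n.
have interp : n%:R * (n%:R * q.[1] - (1 - w) * q^`().[1]) =
    \sum_k q.[z k] * `|\sum_(l < n) z k ^+ l| ^+ 2.
  have -> : q.[1] = \sum_(j < n.+1) q`_j.
    rewrite (horner_coef_wide _ sz_q).
    by apply: eq_bigr => j _; rewrite expr1n mulr1.
  have -> : q^`().[1] = \sum_(j < n.+1) q`_j * j%:R.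
    rewrite (@horner_coef_wide _ n) => [|]; last first.
      by apply: leq_trans (size_poly _ _) _; rewrite -subn1 leq_subLR add1n.
    rewrite big_ord_recl mulr0 add0r; apply: eq_bigr => j _.
    by rewrite coef_deriv expr1n mulr1 mulr_natr.
  rewrite !mulr_sumr -sumrB mulr_sumr.
  under [RHS]eq_bigr => k _ do rewrite (horner_coef_wide _ sz_q) mulr_suml.
  rewrite exchange_big /=; apply: eq_bigr => j _.
  under eq_bigr => k _ do rewrite -mulrA.
  by rewrite -mulr_sumr moments -1?ltnS //; ring.
rewrite -(ler_pM2l (_ : 0 < n%:R)) ?ltr0n //.
rewrite -{1}(normr_nat C n) -normrM interp.
(* The moment with [j = 0] is the total mass of the weights. *)
have -> : n%:R * (n%:R * M) = \sum_k M * `|\sum_(l < n) z k ^+ l| ^+ 2.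
  rewrite -mulr_sumr.
  have := moments 0%N isT; rewrite mul0r subr0.
  under eq_bigr => k _ do rewrite expr0 mul1r.
  by move=> ->; ring.
apply: le_trans (ler_norm_sum _ _ _) _; apply: ler_sum => k _.
by rewrite normrM normrX normr_id ler_wpM2r ?exprn_ge0 ?q_le.
Qed.

End Interpolation.

(** * Multilinear forms: boundedness, derivative on the diagonal, Taylor estimate *)

Section MultilinearForms.
Context {R : realType} {s : scalars}.
Local Notation K := (scalar_field R s).
Context {X : normedModType K}.
Implicit Types (u x y h : X).

Definition cons_row k u (v : 'rV[X]_k) : 'rV[X]_k.+1 :=
  \row_i oapp (v 0) u (unlift ord0 i).

(** Currying: inductions on the number of arguments freeze the first one. *)
Definition fix_first k (L : 'rV[X]_k.+1 -> K^o) u : 'rV[X]_k -> K^o :=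
  fun v => L (cons_row u v).

Definition bounded_form k (C : K) (L : 'rV[X]_k -> K^o) :=
  forall v, `|L v| <= C * \prod_i `|v 0 i|.

Lemma cons_row0 k u (v : 'rV[X]_k) : cons_row u v 0 ord0 = u.
Proof. by rewrite mxE unlift_none. Qed.

Lemma cons_rowS k u (v : 'rV[X]_k) i : cons_row u v 0 (lift ord0 i) = v 0 i.
Proof. by rewrite mxE liftK. Qed.

Lemma cons_row_const k u : cons_row u (const_mx u : 'rV[X]_k) = const_mx u.
Proof.
by apply/rowP => i; rewrite !mxE; case: unliftP => //= j _; rewrite mxE.
Qed.

Lemma cons_row_eta k (v : 'rV[X]_k.+1) :
  v = cons_row (v 0 ord0) (\row_i v 0 (lift ord0 i)).
Proof.
by apply/rowP => i; rewrite !mxE; case: unliftP => [j|] -> //=; rewrite mxE.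
Qed.

Lemma replace_cons_first k u u' (v : 'rV[X]_k) :
  replace_coord (cons_row u v) ord0 u' = cons_row u' v.
Proof.
by apply/rowP => i; rewrite !mxE; case: unliftP => [j|] -> //=; rewrite eqxx.
Qed.

Lemma replace_cons_lift k u u' (v : 'rV[X]_k) i :
  replace_coord (cons_row u v) (lift ord0 i) u' =
  cons_row u (replace_coord v i u').
Proof.
apply/rowP => j; rewrite !mxE; case: unliftP => [j'|] -> //=.
by rewrite (inj_eq lift_inj) mxE.
Qed.

Section Multilinear.
Variables (k : nat) (L : 'rV[X]_k.+1 -> K^o).
Hypothesis L_lin : multilinear_form L.

Lemma fix_firstP (a : K) u u' v :
  fix_first L (a *: u + u') v = a * fix_first L u v + fix_first L u' v.
Proof.
have := L_lin (cons_row u v) ord0 a u u'.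
by rewrite !replace_cons_first.
Qed.

Lemma fix_firstD u u' v :
  fix_first L (u + u') v = fix_first L u v + fix_first L u' v.
Proof. by rewrite -[u]scale1r fix_firstP scale1r mul1r. Qed.

Lemma fix_firstZ (a : K) u v : fix_first L (a *: u) v = a * fix_first L u v.
Proof.
have f0 : fix_first L 0 v = 0.
  by apply: (addrI (fix_first L 0 v)); rewrite -fix_firstD !addr0.
by rewrite -[a *: u]addr0 fix_firstP f0 addr0.
Qed.

Lemma fix_first_multilinear u : multilinear_form (fix_first L u).
Proof.
move=> v i a u1 u2; rewrite /fix_first -!replace_cons_lift.
exact: L_lin.
Qed.

Lemma fix_first_bounded C u :
  bounded_form C L -> bounded_form (C * `|u|) (fix_first L u).
Proof.
move=> L_le v; apply: le_trans (L_le _) _.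
rewrite big_ord_recl cons_row0 mulrA.
rewrite [X in _ * X <= _](eq_bigr (fun i => `|v 0 i|)) // => i _.
by rewrite cons_rowS.
Qed.

End Multilinear.

Lemma multilinear_scale k (L : 'rV[X]_k -> K^o) (a : 'I_k -> K) (v : 'rV[X]_k) :
  multilinear_form L -> L (\row_i (a i *: v 0 i)) = (\prod_i a i) * L v.
Proof.
elim: k L a v => [|k IHk] L a v L_lin.
  by rewrite big_ord0 mul1r; congr (L _); apply/rowP; case.
rewrite [\row_i _]cons_row_eta -/(fix_first L _ _) mxE fix_firstZ //.
have -> : \row_i (\row_j (a j *: v 0 j)) 0 (lift ord0 i) =
    \row_i (a (lift ord0 i) *: (\row_j v 0 (lift ord0 j)) 0 i).
  by apply/rowP => i; rewrite !mxE.
rewrite IHk; last exact: fix_first_multilinear.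
by rewrite mulrA -big_ord_recl /fix_first -cons_row_eta.
Qed.

(** Continuity at 0 bounds [L] on a small ball; multilinearity spreads the bound after each nonzero
    coordinate is rescaled to norm [e / 2]. *)
Lemma continuous_multilinear_bounded k (L : 'rV[X]_k -> K^o) :
  continuous L -> multilinear_form L -> exists2 C, 0 <= C & bounded_form C L.
Proof.
move=> L_cont L_lin.
have /cvgrPdist_lt /(_ 1 ltr01) := L_cont 0.
case/nbhs_ballP => e /= e_gt0 L_le.
(* For [k = 0] the value [L 0] may be nonzero; keeping it in the constant avoids a case
   distinction. *)
pose C0 := 1 + `|L 0|; have C0_ge0 : 0 <= C0 by rewrite addr_ge0.
have e_neq0 : e != 0 by rewrite gt_eqF.
exists (C0 * (2 / e) ^+ k) => [|v].
  by rewrite mulr_ge0 // exprn_ge0 // divr_ge0 ?ler0n ?ltW.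
pose a (i : 'I_k) : K := 2 / e * `|v 0 i|.
pose w : 'rV[X]_k := \row_i ((e / 2) * `|v 0 i|^-1 *: v 0 i).
have v_eq : v = \row_i (a i *: w 0 i).
  apply/rowP => i; rewrite !mxE scalerA /a.
  have [->|v_neq0] := eqVneq (v 0 i) 0; first by rewrite scaler0.
  rewrite -[LHS]scale1r; congr (_ *: _).
  have : `|v 0 i| != 0 by rewrite normr_eq0.
  move=> vi_neq0; rewrite -[e / 2]invf_div -invfM divff // mulf_neq0 //.
  by rewrite mulf_neq0 ?invr_eq0 ?pnatr_eq0.
rewrite {1}v_eq multilinear_scale // normrM.
have w_le : `|L w| <= C0.
  rewrite /C0 -[L w](subrK (L 0)); apply: le_trans (ler_normD _ _) _.
  rewrite lerD2r distrC ltW //; apply: L_le; split=> // i j.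
  rewrite !mxE -ball_normE /= sub0r normrN.
  have [->|v_neq0] := eqVneq (v 0 j) 0; first by rewrite scaler0 normr0.
  rewrite normrZ normrM normfV normr_id -mulrA mulVf ?normr_eq0 // mulr1.
  rewrite ger0_norm; first by rewrite ltr_pdivrMr // mulr_natr mulr2n ltrDl.
  by rewrite divr_ge0 ?ler0n ?ltW.
have -> : `|\prod_i a i| = (2 / e) ^+ k * \prod_i `|v 0 i|.
  rewrite normr_prod -[in (2 / e) ^+ k](card_ord k) -prodr_const -big_split /=.
  apply: eq_bigr => i _; rewrite normrM normr_id ger0_norm //.
  by rewrite divr_ge0 ?ler0n ?ltW.
rewrite mulrC -mulrA; apply: ler_wpM2r w_le.
by rewrite mulr_ge0 ?exprn_ge0 ?divr_ge0 ?prodr_ge0 ?ltW.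
Qed.


(** The sum over all slots of [L] of its value with [h] in that slot and [x] in
    the others: the derivative of [associated_poly L] at [x] along [h]. *)
Fixpoint form_deriv k : ('rV[X]_k -> K^o) -> X -> X -> K^o :=
  match k with
  | 0 => fun _ _ _ => 0
  | k'.+1 => fun L x h =>
      form_deriv (fix_first L x) x h + L (cons_row h (const_mx x))
  end.

Lemma associated_polyS k (L : 'rV[X]_k.+1 -> K^o) x :
  associated_poly L x = associated_poly (fix_first L x) x.
Proof. by rewrite /associated_poly /fix_first cons_row_const. Qed.

Lemma form_deriv_scalar k (L : 'rV[X]_k -> K^o) x :
  multilinear_form L -> scalar (form_deriv L x).
Proof.
elim: k L => [|k IHk] L L_lin a h h' /=; first by rewrite mulr0 addr0.
rewrite (IHk (fix_first L x) _ a) -?/(fix_first L _ _) ?fix_firstP //.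
  by rewrite mulrDr addrACA.
exact: fix_first_multilinear.
Qed.

(** Euler's identity: each of the [k] slots contributes [associated_poly L x]. *)
Lemma form_deriv_diag k (L : 'rV[X]_k -> K^o) x :
  form_deriv L x x = k%:R * associated_poly L x.
Proof.
elim: k L => [|k IHk] L /=; first by rewrite mul0r.
by rewrite IHk -associated_polyS cons_row_const -natr1 mulrDl mul1r.
Qed.

Lemma symmetric_fix_first k (L : 'rV[X]_k.+1 -> K^o) u :
  Defs.symmetric_form L -> Defs.symmetric_form (fix_first L u).
Proof.
move=> L_sym p v; rewrite /fix_first -[RHS](L_sym (lift_perm ord0 ord0 p)).
congr (L _); apply/rowP => i; case: (unliftP ord0 i) => [j|] ->.
  by rewrite cons_rowS [RHS]mxE lift_perm_lift cons_rowS mxE.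
by rewrite [RHS]mxE lift_perm_id !cons_row0.
Qed.

Lemma symmetric_swap k (L : 'rV[X]_k.+2 -> K^o) u u' v :
  Defs.symmetric_form L ->
  fix_first (fix_first L u) u' v = fix_first (fix_first L u') u v.
Proof.
move=> L_sym; rewrite /fix_first -(L_sym (tperm ord0 (lift ord0 ord0))).
congr (L _); apply/rowP => i; rewrite mxE.
case: (unliftP ord0 i) => [j|] ->; last first.
  by rewrite tpermL !cons_rowS !cons_row0.
case: (unliftP ord0 j) => [l|] ->; last first.
  by rewrite tpermR !cons_rowS !cons_row0.
by rewrite tpermD ?cons_rowS //; apply/eqP => /(congr1 val).
Qed.

(** By symmetry all slots contribute equally; [symmetric_swap] moves [h] to the front in the
    induction. *)
Lemma form_deriv_symmetric k (L : 'rV[X]_k.+1 -> K^o) x h :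
  Defs.symmetric_form L ->
  form_deriv L x h = k.+1%:R * associated_poly (fix_first L h) x.
Proof.
elim: k L => [|k IHk] L L_sym; first by rewrite /= add0r mul1r.
rewrite [LHS]/= -/(form_deriv (fix_first L x) x h).
rewrite [form_deriv _ _ _]IHk; last exact: symmetric_fix_first.
rewrite /associated_poly symmetric_swap // -/(associated_poly _ x).
by rewrite -associated_polyS -[k.+2%:R]natr1 mulrDl mul1r.
Qed.

Lemma associated_poly_scale k (L : 'rV[X]_k -> K^o) a x :
  multilinear_form L ->
  associated_poly L (a *: x) = a ^+ k * associated_poly L x.
Proof.
move=> L_lin; rewrite /associated_poly -[in a ^+ k](card_ord k) -prodr_const.
rewrite -multilinear_scale //; congr (L _).
by apply/rowP => i; rewrite !mxE.
Qed.

Section Bounds.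
Variables (B : K) (x h : X).
Hypotheses (B_ge1 : 1 <= B) (x_le : `|x| <= B) (xh_le : `|x + h| <= B).

Let B_ge0 : 0 <= B. Proof. exact: le_trans B_ge1. Qed.

Lemma associated_poly_bound k C (L : 'rV[X]_k -> K^o) u : 0 <= C ->
  bounded_form C L -> `|u| <= B -> `|associated_poly L u| <= C * B ^+ k.
Proof.
move=> C_ge0 L_le u_le; apply: le_trans (L_le _) _; apply: ler_wpM2l => //.
rewrite -[in B ^+ k](card_ord k) -prodr_const; apply: ler_prod => i _.
by rewrite mxE normr_ge0.
Qed.

Lemma bounded_fix_first_le k C (L : 'rV[X]_k.+1 -> K^o) u : 0 <= C ->
  bounded_form C L -> `|u| <= B -> bounded_form (C * B) (fix_first L u).
Proof.
move=> C_ge0 L_le u_le v; apply: le_trans (fix_first_bounded u L_le v) _.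
by rewrite ler_wpM2r ?prodr_ge0 // ler_wpM2l.
Qed.

(** Only [k - 1] slots keep [x], but [1 <= B] allows the exponent [k], which also covers [k = 0]. *)
Lemma form_deriv_bound k C (L : 'rV[X]_k -> K^o) : 0 <= C ->
  bounded_form C L -> `|form_deriv L x h| <= C * k%:R * B ^+ k * `|h|.
Proof.
elim: k C L => [|k IHk] C L C_ge0 L_le.
  by rewrite /= normr0 !(mulr0, mul0r).
apply: le_trans (ler_normD _ _) _.
have le1 := IHk _ _ (mulr_ge0 C_ge0 B_ge0)
  (bounded_fix_first_le C_ge0 L_le x_le).
have le2 : `|L (cons_row h (const_mx x))| <= C * `|h| * B ^+ k.
  exact: (associated_poly_bound (mulr_ge0 C_ge0 (normr_ge0 h))
    (fix_first_bounded h L_le) x_le).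
apply: le_trans (lerD le1 le2) _; rewrite exprS -natr1.
have -> : C * (k%:R + 1) * (B * B ^+ k) * `|h| =
    C * B * k%:R * B ^+ k * `|h| + B * (C * `|h| * B ^+ k) by ring.
by rewrite lerD2l ler_peMl // !mulr_ge0 ?exprn_ge0.
Qed.

(** The vector [x] becomes [x + h] one slot at a time, each change costing a factor [|h|]; hence [B]
    bounds both vectors. *)
Lemma associated_poly_lipschitz k C (L : 'rV[X]_k -> K^o) : 0 <= C ->
  multilinear_form L -> bounded_form C L ->
  `|associated_poly L (x + h) - associated_poly L x| <=
    C * k%:R * B ^+ k * `|h|.
Proof.
elim: k C L => [|k IHk] C L C_ge0 L_lin L_le.
  have -> : associated_poly L (x + h) = associated_poly L x.
    by congr (L _); apply/rowP; case.
  by rewrite subrr normr0 !(mulr0, mul0r).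
rewrite !associated_polyS [associated_poly _ (x + h)]fix_firstD // addrAC.
apply: le_trans (ler_normD _ _) _.
have le1 := IHk _ _ (mulr_ge0 C_ge0 B_ge0)
  (fix_first_multilinear L_lin x) (bounded_fix_first_le C_ge0 L_le x_le).
have le2 : `|fix_first L h (const_mx (x + h))| <= C * `|h| * B ^+ k.
  exact: (associated_poly_bound (mulr_ge0 C_ge0 (normr_ge0 h))
    (fix_first_bounded h L_le) xh_le).
apply: le_trans (lerD le1 le2) _; rewrite exprS -natr1.
have -> : C * (k%:R + 1) * (B * B ^+ k) * `|h| =
    C * B * k%:R * B ^+ k * `|h| + B * (C * `|h| * B ^+ k) by ring.
by rewrite lerD2l ler_peMl // !mulr_ge0 ?exprn_ge0.
Qed.

(** Splitting the first slot leaves the same remainder for [fix_first L x] and the increment of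
    [fix_first L h], whose Lipschitz bound supplies the second factor [|h|]. *)
Lemma associated_poly_taylor k C (L : 'rV[X]_k -> K^o) : 0 <= C ->
  multilinear_form L -> bounded_form C L ->
  `|associated_poly L (x + h) - associated_poly L x - form_deriv L x h| <=
    C * k%:R ^+ 2 * B ^+ k * `|h| ^+ 2.
Proof.
elim: k C L => [|k IHk] C L C_ge0 L_lin L_le.
  have -> : associated_poly L (x + h) = associated_poly L x.
    by congr (L _); apply/rowP; case.
  by rewrite subrr subr0 normr0 !(expr0n, mulr0, mul0r).
rewrite !associated_polyS [associated_poly _ (x + h)]fix_firstD //=.
have regroup (a b c d e : K) : a + b - c - (d + e) = a - c - d + (b - e).
  by ring.
rewrite regroup; apply: le_trans (ler_normD _ _) _.
have le1 := IHk _ _ (mulr_ge0 C_ge0 B_ge0)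
  (fix_first_multilinear L_lin x) (bounded_fix_first_le C_ge0 L_le x_le).
have le2 := associated_poly_lipschitz (mulr_ge0 C_ge0 (normr_ge0 h))
  (fix_first_multilinear L_lin h) (fix_first_bounded h L_le).
apply: le_trans (lerD le1 le2) _; rewrite [B ^+ k.+1]exprS -natr1.
(* From [k] to [k + 1] the square gains [2 k + 1], more than the factor [k] of the Lipschitz
   bound. *)
have -> : C * (k%:R + 1) ^+ 2 * (B * B ^+ k) * `|h| ^+ 2 =
    C * B * k%:R ^+ 2 * B ^+ k * `|h| ^+ 2 +
    C * `|h| * B ^+ k * `|h| * (B * (k%:R *+ 2 + 1)) by ring.
rewrite lerD2l.
have -> : C * `|h| * k%:R * B ^+ k * `|h| =
    C * `|h| * B ^+ k * `|h| * k%:R by ring.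
rewrite ler_wpM2l ?mulr_ge0 ?exprn_ge0 //.
rewrite -[k%:R in leLHS]mul1r ler_pM ?ler0n //.
by rewrite mulr2n -addrA lerDl addr_ge0.
Qed.

End Bounds.
End MultilinearForms.

(** The bound on [l] makes it continuous and the quadratic remainder is [o(h)], so uniqueness of the
    differential applies. *)
Lemma diff_unique_quadratic (K : numFieldType) (X : normedModType K)
    (f : X -> K^o) (l : X -> K^o) (x : X) (A D : K) :
  0 <= A -> 0 <= D -> scalar l ->
  (forall h, `|l h| <= A * `|h|) ->
  (forall h, `|h| <= 1 -> `|f (x + h) - f x - l h| <= D * `|h| ^+ 2) ->
  'd f x = l :> (X -> K^o).
Proof.
move=> A_ge0 D_ge0 l_scalar l_le f_le.
pose l' : {linear X -> K^o} :=
  HB.pack l (GRing.isLinear.Build K X K^o *:%R l l_scalar).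
apply: (@diff_unique _ _ _ f l' x).
  apply/bounded_linear_continuous/bounded_funP => r; exists (A * r) => h h_le.
  by apply: le_trans (l_le h) _; rewrite ler_wpM2l.
apply/eqaddoP => e e_gt0 /=; apply/nbhs_norm0P.
have eD_gt0 : 0 < e + D + 1 by rewrite addr_gt0 ?ltr_wpDr.
(* This radius is at most 1, where the quadratic bound holds, and [D] times it is at most [e]. *)
exists (e / (e + D + 1)); first by rewrite /= divr_gt0.
move=> h /= h_lt.
have h_le1 : `|h| <= 1.
  apply: le_trans (ltW h_lt) _.
  by rewrite ler_pdivrMr // mul1r -addrA lerDl addr_ge0.
rewrite -[X in `|X|]/(f (h + x) - (f x + l h)) [h + x]addrC opprD addrA.
apply: le_trans (f_le h h_le1) _; rewrite expr2 mulrA ler_wpM2r //.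
apply: le_trans (ler_wpM2l D_ge0 (ltW h_lt)) _.
rewrite mulrCA ler_piMr ?ltW // ltr_pdivrMr // mul1r.
by rewrite addrAC ltrDr addr_gt0.
Qed.

(** * Passage between real numbers, scalars and complex numbers *)

Section ScalarField.
Context {R : realType} {s : scalars}.
Local Notation K := (scalar_field R s).

(** Real scalars also enter [R[i]], so that one argument with complex polynomials serves both
    fields. *)
Definition to_complex : K -> R[i] :=
  match s with RealScalars => real_complex R | ComplexScalars => idfun end.

Definition of_real : R -> K :=
  match s with RealScalars => idfun | ComplexScalars => real_complex R end.

Lemma to_complexD a b : to_complex (a + b) = to_complex a + to_complex b.
Proof. by rewrite /to_complex; case: s a b => a b //=; rewrite rmorphD. Qed.

Lemma to_complexM a b : to_complex (a * b) = to_complex a * to_complex b.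
Proof. by rewrite /to_complex; case: s a b => a b //=; rewrite rmorphM. Qed.

Lemma to_complex0 : to_complex 0 = 0.
Proof. by rewrite /to_complex; case: s => //=; rewrite rmorph0. Qed.

Lemma to_complex_of_real a : to_complex (of_real a) = a%:C%C.
Proof. by rewrite /to_complex /of_real; case: s. Qed.

Lemma norm_to_complex z : `|to_complex z| = (modulus z)%:C%C.
Proof.
rewrite /to_complex /modulus; case: s z => z.
  by rewrite normc_def /= expr0n addr0 sqrtr_sqr.
exact/esym/RRe_real/normr_real.
Qed.

Lemma of_real_modulus z : of_real (modulus z) = `|z|.
Proof.
by rewrite /of_real /modulus; case: s z => z //; exact/RRe_real/normr_real.
Qed.

Lemma of_realM a b : of_real (a * b) = of_real a * of_real b.
Proof. by rewrite /of_real; case: s => //=; rewrite rmorphM. Qed.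

Lemma of_realD a b : of_real (a + b) = of_real a + of_real b.
Proof. by rewrite /of_real; case: s => //=; rewrite rmorphD. Qed.

Lemma of_real1 : of_real 1 = 1.
Proof. by rewrite /of_real; case: s => //=; rewrite rmorph1. Qed.

Lemma ler_of_real a b : (of_real a <= of_real b) = (a <= b).
Proof. by rewrite /of_real; case: s => //=; rewrite lecR. Qed.

Lemma of_real0 : of_real 0 = 0.
Proof. by rewrite /of_real; case: s => //=; rewrite rmorph0. Qed.

Lemma of_realX a k : of_real (a ^+ k) = of_real a ^+ k.
Proof. by elim: k => [|k IHk]; rewrite ?of_real1 // !exprS of_realM IHk. Qed.

Lemma of_real_nat k : of_real k%:R = k%:R.
Proof.
by elim: k => [|k IHk]; rewrite ?of_real0 // -!natr1 of_realD IHk of_real1.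
Qed.

Lemma of_real_inj : injective of_real.
Proof. by move=> a b /eqP; rewrite eq_le !ler_of_real -eq_le => /eqP. Qed.

Lemma modulus_ge0 (z : K) : 0 <= modulus z.
Proof. by rewrite -ler_of_real of_real_modulus of_real0. Qed.

Lemma norm_of_real a : `|of_real a| = of_real `|a|.
Proof.
rewrite /of_real; case: s => //=.
by rewrite normc_def /= expr0n addr0 sqrtr_sqr.
Qed.

Lemma modulus_of_real a : modulus (of_real a : K) = `|a|.
Proof. by apply: of_real_inj; rewrite of_real_modulus norm_of_real. Qed.

Lemma modulusM (a b : K) : modulus (a * b) = modulus a * modulus b.
Proof. by apply: of_real_inj; rewrite of_realM !of_real_modulus normrM. Qed.

Lemma modulus_leD (a b : K) : modulus (a + b) <= modulus a + modulus b.
Proof. by rewrite -ler_of_real of_realD !of_real_modulus ler_normD. Qed.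

Lemma ler_modulus (z : K) M : (modulus z <= M) = (`|z| <= of_real M).
Proof. by rewrite -ler_of_real of_real_modulus. Qed.

End ScalarField.

(** * Restriction of a homogeneous polynomial to a circle *)

Section TrigPolynomial.
Context {R : realType} {s : scalars}.
Local Notation K := (scalar_field R s).
Context {X : normedModType K}.
Local Notation C := R[i].

(** On the unit circle these take the values [z * Re z] and [z * Im z]. *)
Definition cos_poly : {poly C} := 2^-1 *: ('X^2 + 1).
Definition sin_poly : {poly C} := (2 * 'i)^-1 *: ('X^2 - 1).

(** [c] and [d] are the real and imaginary parts of [z]; the conjugate in their formulas disappears
    through [z * z^* = 1]. *)
Lemma unit_circleP (z : C) : `|z| = 1 -> exists c d : R,
  [/\ c ^+ 2 + d ^+ 2 = 1, cos_poly.[z] = z * c%:C%C &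
      sin_poly.[z] = z * d%:C%C].
Proof.
move=> z1; exists (complex.Re z), (complex.Im z).
have zJ : z * z^* = 1 by rewrite -normCK z1 expr1n.
split.
- by apply: complexI; rewrite add_Re2_Im2 z1 expr1n.
- rewrite complexRe ReE mulrA mulrDr zJ hornerZ hornerD hornerXn hornerC mulrC.
  by rewrite expr2.
- rewrite complexIm ImE !mulrA -[_ * 'i * _]mulrAC mulrBr zJ.
  rewrite hornerZ hornerD hornerN hornerXn hornerC invfM invCi; ring.
Qed.

(** The polynomial whose value at [z = c + i d] on the unit circle is
    [z^k L(u, ..., u)] for [u = c x + d y]; [to_complex] embeds the scalars. *)
Fixpoint trig_poly k : ('rV[X]_k -> K^o) -> X -> X -> {poly C} :=
  match k with
  | 0 => fun L x y => (to_complex (L 0))%:P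
  | k'.+1 => fun L x y =>
      cos_poly * trig_poly (fix_first L x) x y +
      sin_poly * trig_poly (fix_first L y) x y
  end.

Lemma size_trig_poly k (L : 'rV[X]_k -> K^o) x y :
  (size (trig_poly L x y) <= (k + k).+1)%N.
Proof.
have size_deg2 (a b : C) (p : {poly C}) m : (size p <= m)%N ->
    (size (a *: ('X^2 + b%:P) * p)%R <= m.+2)%N.
  move=> p_le; apply: leq_trans (size_polyMleq _ _) _.
  have : (size (a *: ('X^2 + b%:P))%R <= 3)%N.
    apply: leq_trans (size_scale_leq _ _) _.
    rewrite (leq_trans (size_polyD _ _)) // size_polyXn size_polyC.
    by case: (b != 0).
  move=> d_le; rewrite -subn1 leq_subLR.
  by apply: leq_trans (leq_add d_le p_le) _.
elim: k L => [|k IHk] L /=; first by rewrite size_polyC; case: (_ != 0).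
apply: leq_trans (size_polyD _ _) _; rewrite geq_max addSn addnS.
rewrite /cos_poly /sin_poly -polyC1 -polyCN.
by rewrite !size_deg2.
Qed.

Lemma trig_poly_circle k (L : 'rV[X]_k -> K^o) x y z (c d : R) :
  multilinear_form L ->
  cos_poly.[z] = z * c%:C%C -> sin_poly.[z] = z * d%:C%C ->
  (trig_poly L x y).[z] =
    z ^+ k * to_complex (associated_poly L (of_real c *: x + of_real d *: y)).
Proof.
move=> L_lin cz dz; elim: k L L_lin => [|k IHk] L L_lin /=.
  by rewrite hornerC mul1r; congr (to_complex (L _)); apply/rowP; case.
rewrite hornerD !hornerM cz dz !IHk; try exact: fix_first_multilinear.
set u := of_real c *: x + of_real d *: y.
have -> : associated_poly L u = of_real c * associated_poly (fix_first L x) u +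
    of_real d * associated_poly (fix_first L y) u.
  by rewrite associated_polyS [LHS]fix_firstP // fix_firstZ.
rewrite to_complexD !to_complexM !to_complex_of_real exprS; ring.
Qed.

Lemma cos_poly1 : cos_poly.[1] = 1.
Proof. by rewrite !hornerE; field. Qed.
Lemma sin_poly1 : sin_poly.[1] = 0.
Proof. by rewrite !hornerE expr1n subrr mulr0. Qed.
Lemma deriv_cos_poly1 : cos_poly^`().[1] = 1.
Proof. by rewrite derivZ derivD derivXn derivC !hornerE /= ?mulr1n; field. Qed.
Lemma deriv_sin_poly1 : sin_poly^`().[1] = - 'i.
Proof.
by rewrite derivZ derivB derivXn derivC !hornerE /= ?mulr1n invfM invCi; field.
Qed.

Lemma trig_poly1 k (L : 'rV[X]_k -> K^o) x y :
  (trig_poly L x y).[1] = to_complex (associated_poly L x).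
Proof.
elim: k L => [|k IHk] L /=.
  by rewrite hornerC; congr (to_complex (L _)); apply/rowP; case.
rewrite hornerD !hornerM cos_poly1 sin_poly1 mul0r addr0 mul1r IHk.
by rewrite -associated_polyS.
Qed.

(** Differentiating the factor of one slot gives 1 for [cos_poly], which keeps [x], and [- 'i] for
    [sin_poly], which inserts [y]. As [sin_poly] vanishes at 1, all other slots keep [x]. *)
Lemma deriv_trig_poly1 k (L : 'rV[X]_k -> K^o) x y :
  (trig_poly L x y)^`().[1] =
    k%:R * to_complex (associated_poly L x) -
    'i * to_complex (form_deriv L x y).
Proof.
elim: k L => [|k IHk] L /=.
  by rewrite derivC horner0 to_complex0 mulr0 mul0r subrr.
rewrite derivD !derivM !hornerD !hornerM cos_poly1 sin_poly1.
rewrite deriv_cos_poly1 deriv_sin_poly1 !trig_poly1 IHk.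
rewrite -associated_polyS to_complexD -natr1.
by rewrite -[L _]/(associated_poly (fix_first L y) x); ring.
Qed.

End TrigPolynomial.

(** * Orthogonality for the inner product *)

Section Pythagoras.
Context {R : realType} {s : scalars}.
Local Notation K := (scalar_field R s).
Context {H : normedModType K} (dot : {dot H for @scalar_conj R s}).
Hypothesis norm_dot : forall u : H, `|u| ^+ 2 = dot u u.
Implicit Types u v x y z : H.

Lemma dot_conj u v : dot u v = scalar_conj (dot v u).
Proof. by rewrite [LHS]hermitian_subproof expr0 mul1r. Qed.

Lemma scalar_conj0 : scalar_conj (0 : K) = 0.
Proof. by rewrite /scalar_conj; case: s => //=; rewrite rmorph0. Qed.

Lemma pythagoras u v : dot u v = 0 -> `|u + v| ^+ 2 = `|u| ^+ 2 + `|v| ^+ 2.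
Proof.
move=> uv0; have vu0 : dot v u = 0 by rewrite dot_conj uv0 scalar_conj0.
by rewrite !norm_dot linearDl !linearDr /= uv0 vu0 addr0 add0r.
Qed.

Lemma norm_comb_orthogonal x y (a b : K) : dot x y = 0 ->
  `|x| <= 1 -> `|y| <= 1 -> `|a| ^+ 2 + `|b| ^+ 2 <= 1 ->
  `|a *: x + b *: y| <= 1.
Proof.
move=> xy0 x_le y_le ab_le.
have xyab0 : dot (a *: x) (b *: y) = 0.
  by rewrite linearZl_LR linearZr_LR /= xy0 !mulr0.
rewrite -(@ler_pXn2r _ 2) ?nnegrE // expr1n pythagoras //.
apply: le_trans ab_le; rewrite !normrZ !exprMn.
by apply: lerD; rewrite ler_piMr ?exprn_ge0 // exprn_ile1.
Qed.

Lemma orthogonal_decomposition x z : `|x| = 1 -> exists a b y,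
  [/\ z = a *: x + b *: y, dot x y = 0, `|y| <= 1 &
      `|a| ^+ 2 + `|b| ^+ 2 = `|z| ^+ 2].
Proof.
move=> x1; pose a := dot z x; pose v := z - a *: x.
have vx0 : dot v x = 0.
  by rewrite linearBl linearZl_LR /= -norm_dot x1 expr1n mulr1 subrr.
have xv0 : dot x v = 0 by rewrite dot_conj vx0 scalar_conj0.
(* If [v] is 0 then so is [y]; hence the norm of [y] is only claimed to be at most 1. *)
exists a, `|v|, (`|v|^-1 *: v); split.
- have [v0|v_neq0] := eqVneq v 0.
    by rewrite v0 normr0 scale0r addr0; apply/eqP; rewrite -subr_eq0 -/v v0.
  by rewrite scalerA divff ?normr_eq0 // scale1r addrC subrK.
- by rewrite linearZr_LR /= xv0 mulr0.
- rewrite normrZ normfV normr_id.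
  have [->|v_neq0] := eqVneq v 0; first by rewrite normr0 mulr0.
  by rewrite mulVf ?normr_eq0.
- have axv0 : dot (a *: x) v = 0 by rewrite linearZl_LR /= xv0 mulr0.
  have z_eq : z = a *: x + v by rewrite addrC subrK.
  by rewrite [in RHS]z_eq pythagoras // normrZ x1 mulr1 normr_id.
Qed.

End Pythagoras.

Lemma polar_form (K : numFieldType) (z : K) :
  exists2 sg, `|sg| = 1 & z = sg * `|z|.
Proof.
have [->|z_neq0] := eqVneq z 0.
  by exists 1; rewrite ?normr1 ?normr0 ?mulr0.
exists (z / `|z|); last by rewrite divfK ?normr_eq0.
by rewrite normrM normfV normr_id divff ?normr_eq0.
Qed.

(** * A Bernstein-Szego inequality for finite sums of homogeneous polynomials *)

Section PolynomialEstimate.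
Context {R : realType} {s : scalars}.
Local Notation K := (scalar_field R s).
Context {X : normedModType K} (n : nat) (I : finType) (deg : I -> nat).
Context (L : forall i, 'rV[X]_(deg i) -> K^o).
Variables (C : I -> K) (P : X -> K^o).
Hypotheses (L_lin : forall k, multilinear_form (@L k)).
Hypothesis C_ge0 : forall k, 0 <= C k.
Hypothesis L_le : forall k, bounded_form (C k) (@L k).
Hypothesis deg_le : forall k, (deg k <= n)%N.
Hypothesis P_sum : forall x, P x = \sum_k associated_poly (@L k) x.

Lemma diff_poly x :
  'd P x = (fun h => \sum_k form_deriv (@L k) x h) :> (X -> K^o).
Proof.
(* For [|h| <= 1] this bounds both [|x|] and [|x + h|]. *)
pose B : K := `|x| + 1; have B_ge1 : 1 <= B by rewrite lerDr.
have B_ge0 : 0 <= B by exact: le_trans B_ge1.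
have x_le : `|x| <= B by rewrite lerDl.
apply: (@diff_unique_quadratic _ _ _ _ _ (\sum_k C k * (deg k)%:R * B ^+ deg k)
    (\sum_k C k * (deg k)%:R ^+ 2 * B ^+ deg k)).
- by apply: sumr_ge0 => k _; rewrite !mulr_ge0 ?exprn_ge0.
- by apply: sumr_ge0 => k _; rewrite !mulr_ge0 ?exprn_ge0.
- move=> a h h'; rewrite mulr_sumr -big_split; apply: eq_bigr => k _.
  exact: form_deriv_scalar.
- move=> h; rewrite mulr_suml; apply: le_trans (ler_norm_sum _ _ _) _.
  by apply: ler_sum => k _; exact: form_deriv_bound.
move=> h h_le; rewrite !P_sum -!sumrB mulr_suml.
apply: le_trans (ler_norm_sum _ _ _) _; apply: ler_sum => k _.
apply: associated_poly_taylor => //.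
by apply: le_trans (ler_normD _ _) _; rewrite lerD2l.
Qed.

Lemma poly_bounded x : `|x| <= 1 -> `|P x| <= \sum_k C k.
Proof.
move=> x_le; rewrite P_sum; apply: le_trans (ler_norm_sum _ _ _) _.
apply: ler_sum => k _.
have := associated_poly_bound (C_ge0 k) (@L_le k) x_le.
by rewrite expr1n mulr1.
Qed.

Variable M : R.
Hypothesis P_le : forall x, `|x| <= 1 -> modulus (P x) <= M.

(** Orthogonality enters only through the hypothesis that the real circle spanned by [x] and [y]
    stays in the unit ball. *)
Lemma bernstein_szego_rotation x y : (0 < n)%N ->
  (forall a b : R, a ^+ 2 + b ^+ 2 = 1 ->
    `|of_real a *: x + of_real b *: y| <= 1) ->
  forall c d : R, c ^+ 2 + d ^+ 2 = 1 ->
  modulus (n%:R * of_real c * P x + of_real d * 'd P x y : K) <= n%:R * M.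
Proof.
move=> n_gt0 xy_le c d cd1.
(* The powers of ['X] give all components the common factor [z ^+ n] on the circle. *)
pose q : {poly R[i]} := \sum_k 'X^(n - deg k) * trig_poly (@L k) x y.
have size_q : (size q <= (n + n).+1)%N.
  apply: leq_trans (size_sum _ _ _) _; apply/bigmax_leqP => k _.
  apply: leq_trans (size_polyMleq _ _) _; rewrite size_polyXn addSn /=.
  apply: leq_trans (leq_add (leqnn _) (size_trig_poly _ _ _)) _.
  by rewrite addnS addnA subnK // ltnS leq_add2l.
have q_le z : `|z| = 1 -> `|q.[z]| <= M%:C%C.
  move=> z1; have [a [b [ab1 za zb]]] := unit_circleP z1.
  have -> : q.[z] = z ^+ n * to_complex (P (of_real a *: x + of_real b *: y)).
    rewrite P_sum (big_morph _ to_complexD to_complex0) mulr_sumr horner_sum.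
    apply: eq_bigr => k _.
    rewrite hornerM hornerXn (trig_poly_circle _ _ _ za zb) //.
    by rewrite mulrA -exprD subnK.
  rewrite normrM normrX z1 expr1n mul1r norm_to_complex lecR.
  by apply: P_le; exact: xy_le.
have q1 : q.[1] = to_complex (P x).
  rewrite P_sum (big_morph _ to_complexD to_complex0) horner_sum.
  by apply: eq_bigr => k _; rewrite hornerM hornerXn expr1n mul1r trig_poly1.
have dq1 : q^`().[1] = n%:R * to_complex (P x) - 'i * to_complex ('d P x y).
  rewrite diff_poly P_sum !(big_morph _ to_complexD to_complex0).
  rewrite !mulr_sumr -sumrB [q^`()]linear_sum horner_sum /=.
  apply: eq_bigr => k _.
  rewrite derivM derivXn hornerD !hornerM hornerMn !hornerXn !expr1n mul1r.
  rewrite trig_poly1 deriv_trig_poly1 -mulr_natl mulr1 addrA -mulrDl.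
  by rewrite -natrD subnK.
pose u : R[i] := c%:C%C + 'i * d%:C%C.
have cd1C : c%:C%C ^+ 2 + d%:C%C ^+ 2 = 1 :> R[i].
  by rewrite -!rmorphXn -rmorphD cd1 rmorph1.
have u1 : `|u| = 1.
  apply/eqP; rewrite -(@pexpr_eq1 _ _ 2) // normC2_rect ?cd1C //.
    by rewrite complex_real.
  by rewrite complex_real.
have NN_gt0 : (0 < n + n)%N by rewrite addn_gt0 n_gt0.
have u2 : `|u ^+ 2| = 1 by rewrite normrX u1 expr1n.
(* Double-angle formulas: [e1] and [e2] share the factor [2 * u], whose modulus 2 cancels against
   the degree [n + n]. *)
have e1 : 1 + u ^+ 2 = 2 * c%:C%C * u.
  rewrite -[X in X + _]cd1C /u sqrrD exprMn sqrCi; ring.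
have e2 : 'i * (1 - u ^+ 2) = 2 * d%:C%C * u.
  rewrite -[X in X - _]cd1C /u; apply: subr0_eq.
  transitivity
    (- (2 * c%:C%C * d%:C%C + 'i * d%:C%C ^+ 2) * ('i ^+ 2 + 1) : R[i]).
    by ring.
  by rewrite sqrCi addNr mulr0.
have wE : to_complex (n%:R * of_real c * P x + of_real d * 'd P x y : K) =
    n%:R * c%:C%C * to_complex (P x) + d%:C%C * to_complex ('d P x y).
  rewrite to_complexD !to_complexM !to_complex_of_real.
  by rewrite -[n%:R in LHS]of_real_nat to_complex_of_real rmorph_nat.
have := polar_derivative_bound NN_gt0 size_q u2 q_le.
have -> : (n + n)%:R * q.[1] - (1 - u ^+ 2) * q^`().[1] =
    2 * u * to_complex (n%:R * of_real c * P x + of_real d * 'd P x y : K).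
  rewrite q1 dq1 natrD wE.
  transitivity (n%:R * to_complex (P x) * (1 + u ^+ 2) +
    'i * (1 - u ^+ 2) * to_complex ('d P x y)); first by ring.
  rewrite e1 e2; ring.
rewrite !normrM u1 mulr1 normr_nat norm_to_complex natrD.
have -> : (n%:R + n%:R) * M%:C%C = 2 * (n%:R * M%:C%C) by ring.
have -> : n%:R * M%:C%C = (n%:R * M)%:C%C by rewrite rmorphM rmorph_nat.
by rewrite ler_pM2l ?ltr0n // lecR.
Qed.

Lemma bernstein_szego_orthogonal x y : (0 < n)%N ->
  (forall a b : K, `|a| ^+ 2 + `|b| ^+ 2 <= 1 -> `|a *: x + b *: y| <= 1) ->
  (n%:R * modulus (P x)) ^+ 2 + modulus ('d P x y) ^+ 2 <= (n%:R * M) ^+ 2.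
Proof.
move=> n_gt0 xy_le; have [sg sg1 Px_eq] := polar_form (P x : K).
(* [phi] turns ['d P x y] to the phase [sg] of [P x]. It is 0 when the derivative vanishes, so only
   [|phi| <= 1] holds in general, which suffices for [xy_le]. *)
pose phi : K := sg * (`|'d P x y| / 'd P x y).
have phi_d : phi * 'd P x y = sg * of_real (modulus ('d P x y)).
  rewrite of_real_modulus /phi -mulrA; congr (_ * _).
  have [->|d_neq0] := eqVneq ('d P x y) 0; first by rewrite normr0 mulr0.
  by rewrite divfK.
have phi_le : `|phi| <= 1.
  rewrite /phi normrM sg1 mul1r normrM normfV normr_id.
  have [->|d_neq0] := eqVneq ('d P x y) 0; first by rewrite normr0 mul0r.
  by rewrite divff ?normr_eq0.
have scalar_le c d : c ^+ 2 + d ^+ 2 = 1 ->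
    n%:R * modulus (P x) * c + modulus ('d P x y) * d <= n%:R * M.
  move=> cd1.
  have rot_le a b : a ^+ 2 + b ^+ 2 = 1 ->
      `|of_real a *: x + of_real b *: (phi *: y)| <= 1.
    move=> ab1; rewrite scalerA; apply: xy_le.
    rewrite normrM exprMn !norm_of_real -!of_realX !(real_normK (num_real _)).
    rewrite -[leRHS]of_real1 -ab1 of_realD lerD2l ler_piMr ?exprn_ile1 //.
    by rewrite -of_real0 ler_of_real sqr_ge0.
  have := bernstein_szego_rotation n_gt0 rot_le cd1.
  have -> : n%:R * of_real c * P x + of_real d * 'd P x (phi *: y) =
      sg * of_real (n%:R * modulus (P x) * c + modulus ('d P x y) * d) :> K.
    have -> : 'd P x (phi *: y) = phi * 'd P x y by rewrite linearZ.
    have {1}-> : P x = sg * of_real (modulus (P x)) by rewrite of_real_modulus.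
    by rewrite phi_d of_realD !of_realM of_real_nat; ring.
  apply: le_trans.
  rewrite modulusM modulus_of_real.
  have -> : modulus sg = 1.
    by apply: (@of_real_inj R s); rewrite of_real_modulus sg1 of_real1.
  by rewrite mul1r ler_norm.
set a := n%:R * modulus (P x) in scalar_le *.
set b := modulus ('d P x y) in scalar_le *.
clearbody a b.
have ab_ge0 : 0 <= a ^+ 2 + b ^+ 2 by rewrite addr_ge0 ?sqr_ge0.
(* The best point of the circle is [(a, b) / r], where the left side of [scalar_le] equals [r]. *)
pose r := Num.sqrt (a ^+ 2 + b ^+ 2).
have r2 : r ^+ 2 = a ^+ 2 + b ^+ 2 by rewrite sqr_sqrtr.
have [r0|r_neq0] := eqVneq r 0; first by rewrite -r2 r0 expr0n sqr_ge0.
have cd1 : (a / r) ^+ 2 + (b / r) ^+ 2 = 1.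
  by rewrite !exprMn -mulrDl -r2 -exprMn divff // expr1n.
have := scalar_le _ _ cd1.
have -> : a * (a / r) + b * (b / r) = r.
  by transitivity (r ^+ 2 / r); [rewrite r2; ring|rewrite expr2 mulfK].
move=> r_le; rewrite -r2 ler_pXn2r // ?nnegrE ?sqrtr_ge0 //.
by apply: le_trans r_le; rewrite sqrtr_ge0.
Qed.

End PolynomialEstimate.

Lemma modulus_nat (R : realType) (s : scalars) k :
  modulus (k%:R : scalar_field R s) = k%:R.
Proof. by rewrite -of_real_nat modulus_of_real normr_nat. Qed.

(** * Single homogeneous polynomials and suprema over the unit ball *)

Section SingleForm.
Context {R : realType} {s : scalars}.
Local Notation K := (scalar_field R s).
Context {X : normedModType K} (k : nat) (L : 'rV[X]_k -> K^o) (C : K).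
Hypotheses (L_lin : multilinear_form L) (C_ge0 : 0 <= C).
Hypothesis L_le : bounded_form C L.

Lemma associated_poly_modulus_le x :
  `|x| <= 1 -> modulus (associated_poly L x) <= modulus C.
Proof.
move=> x_le; rewrite ler_modulus of_real_modulus (ger0_norm C_ge0).
by have := associated_poly_bound C_ge0 L_le x_le; rewrite expr1n mulr1.
Qed.

Lemma diff_associated_poly x :
  'd (associated_poly L) x = form_deriv L x :> (X -> K^o).
Proof.
have P_sum u : associated_poly L u = \sum_(i < 1) associated_poly L u.
  by rewrite big_ord1.
rewrite (diff_poly (fun=> L_lin) (fun=> C_ge0) (fun=> L_le) P_sum).
by apply/funext => h; rewrite big_ord1.
Qed.

End SingleForm.

Section SupNorm.
Context {R : realType} {s : scalars}.
Local Notation K := (scalar_field R s).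
Context {X : normedModType K}.

Lemma sup_norm_le (P : X -> K^o) B :
  (forall x, `|x| <= 1 -> modulus (P x) <= B) -> sup_norm P <= B.
Proof.
move=> P_le; apply: ge_sup.
  by exists (modulus (P 0)), 0 => //=; rewrite normr0.
by move=> _ [x x_le <-]; exact: P_le.
Qed.

(** [B] certifies that the set of values is bounded, so that [sup] is a genuine upper bound and not
    the default 0. *)
Lemma modulus_le_sup_norm (P : X -> K^o) B x :
  (forall x, `|x| <= 1 -> modulus (P x) <= B) -> `|x| <= 1 ->
  modulus (P x) <= sup_norm P.
Proof.
move=> P_le x_le; apply: ub_le_sup; last by exists x.
by exists B => _ [y y_le <-]; exact: P_le.
Qed.

End SupNorm.

Lemma cauchy_schwarz2 (F : realDomainType) (a b p q : F) :
  a ^+ 2 + b ^+ 2 <= 1 -> (a * p + b * q) ^+ 2 <= p ^+ 2 + q ^+ 2.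
Proof.
move=> ab_le; apply: le_trans (_ : (a ^+ 2 + b ^+ 2) * (p ^+ 2 + q ^+ 2) <= _).
  (* Lagrange's identity: the gap between the two sides is this square. *)
  by have := sqr_ge0 (a * q - b * p); nra.
by rewrite ler_piMl ?addr_ge0 ?sqr_ge0.
Qed.

(** * Derivative and polarization bounds in an inner product space *)

Section HilbertSpace.
Context {R : realType} {s : scalars}.
Local Notation K := (scalar_field R s).
Context {H : normedModType K} (dot : {dot H for @scalar_conj R s}).
Hypothesis norm_dot : forall u : H, `|u| ^+ 2 = dot u u.

(** With [z = a *: x + b *: y] and [y] orthogonal to [x], Cauchy-Schwarz bounds the left side by the
    sum of the squares for [x] and [y]; the orthogonal estimate controls the latter. *)
Lemma derivative_bound n (I : finType) (deg : I -> nat)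
    (L : forall i, 'rV[H]_(deg i) -> K^o) (C : I -> K) (P : H -> K^o) M :
  (0 < n)%N -> (forall i, multilinear_form (@L i)) -> (forall i, 0 <= C i) ->
  (forall i, bounded_form (C i) (@L i)) -> (forall i, (deg i <= n)%N) ->
  (forall x, P x = \sum_i associated_poly (@L i) x) ->
  (forall x, `|x| <= 1 -> modulus (P x) <= M) ->
  forall x z, `|x| = 1 -> `|z| <= 1 ->
  modulus ('d P x z) ^+ 2 <= modulus ('d P x x) ^+ 2 +
    ((n%:R * M) ^+ 2 - (n%:R * modulus (P x)) ^+ 2).
Proof.
move=> n_gt0 L_lin C_ge0 L_le deg_le P_sum P_le x z x1 z_le.
have [a [b [y [z_eq xy0 y_le ab]]]] := orthogonal_decomposition norm_dot z x1.
have xy_le (a' b' : K) : `|a'| ^+ 2 + `|b'| ^+ 2 <= 1 ->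
    `|a' *: x + b' *: y| <= 1.
  by move=> ab'; apply: (norm_comb_orthogonal norm_dot xy0) => //; rewrite x1.
have orth_le := bernstein_szego_orthogonal L_lin C_ge0 L_le deg_le P_sum P_le
  n_gt0 xy_le.
have ab_le : modulus a ^+ 2 + modulus b ^+ 2 <= 1.
  rewrite -(@ler_of_real R s) of_realD !of_realX !of_real_modulus of_real1 ab.
  by rewrite exprn_ile1.
have -> : 'd P x z = a * 'd P x x + b * 'd P x y.
  by rewrite z_eq linearP linearZ.
have dz_le := modulus_leD (a * 'd P x x) (b * 'd P x y).
rewrite !modulusM in dz_le.
apply: (@le_trans _ _ ((modulus a * modulus ('d P x x : K) +
    modulus b * modulus ('d P x y : K)) ^+ 2)).
  by rewrite ler_pXn2r ?nnegrE ?modulus_ge0 ?addr_ge0 ?mulr_ge0 ?modulus_ge0.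
apply: (@le_trans _ _
  (modulus ('d P x x : K) ^+ 2 + modulus ('d P x y : K) ^+ 2)).
  exact: cauchy_schwarz2.
by rewrite lerD2l lerBrDl.
Qed.

(** On the unit sphere Euler's identity cancels the two terms of [derivative_bound] other than
    [(k%:R * M) ^+ 2]. For [k > 0], homogeneity of degree [k - 1] in [x] extends the bound to the
    ball. *)
Lemma form_deriv_le k (L : 'rV[H]_k -> K^o) C M :
  multilinear_form L -> Defs.symmetric_form L -> 0 <= C -> bounded_form C L ->
  (forall x, `|x| <= 1 -> modulus (associated_poly L x) <= M) ->
  forall x h, `|x| <= 1 -> `|h| <= 1 ->
  modulus (form_deriv L x h) <= k%:R * M.
Proof.
move=> L_lin L_sym C_ge0 L_le P_le.
have M_ge0 : 0 <= M.
  by apply: le_trans (P_le 0 _); rewrite ?normr0 ?modulus_ge0.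
have P_sum x : associated_poly L x = \sum_(i < 1) associated_poly L x.
  by rewrite big_ord1.
have kM_ge0 : 0 <= k%:R * M by rewrite mulr_ge0.
have mod0 : modulus (0 : K) = 0.
  by exact: (@modulus_nat R s 0).
case: k L L_lin L_sym L_le P_le P_sum kM_ge0 =>
    [|k] L L_lin L_sym L_le P_le P_sum kM_ge0.
  by move=> x h _ _; rewrite /= mul0r mod0.
have diff_P := diff_associated_poly L_lin C_ge0 L_le.
have unit_le e h : `|e| = 1 -> `|h| <= 1 ->
    modulus (form_deriv L e h) <= k.+1%:R * M.
  move=> e1 h_le.
  have := @derivative_bound k.+1 'I_1 (fun=> k.+1) (fun=> L) (fun=> C) _ M
    isT (fun=> L_lin) (fun=> C_ge0) (fun=> L_le) (fun=> leqnn _) P_sum P_le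
    e h e1 h_le.
  rewrite !diff_P form_deriv_diag modulusM modulus_nat addrC subrK.
  by rewrite ler_pXn2r // ?nnegrE ?modulus_ge0.
have scale_le e h (c : K) : `|e| = 1 -> `|h| <= 1 -> `|c| <= 1 ->
    modulus (form_deriv L (c *: e) h) <= k.+1%:R * M.
  move=> e1 h_le c_le.
  have -> : form_deriv L (c *: e) h = c ^+ k * form_deriv L e h.
    rewrite !(form_deriv_symmetric _ _ L_sym).
    rewrite (associated_poly_scale _ _ (fix_first_multilinear L_lin h)).
    by rewrite mulrCA.
  rewrite modulusM; apply: le_trans (unit_le e h e1 h_le).
  by rewrite ler_piMl ?modulus_ge0 // ler_modulus of_real1 normrX exprn_ile1.
have unit_normalize u : u != 0 -> `|(`|u|^-1 *: u : H)| = 1.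
  by move=> u_neq0; rewrite normrZ normfV normr_id mulVf ?normr_eq0.
(* The zero vector is written as 0 times the unit vector along [h]; if [h] vanishes too, linearity
   gives 0. *)
move=> x h x_le h_le; have [->|x_neq0] := eqVneq x 0.
  have [->|h_neq0] := eqVneq h 0.
    by rewrite -diff_P linear0 mod0.
  rewrite -(scale0r (`|h|^-1 *: h)).
  by apply: scale_le => //; [exact: unit_normalize|rewrite normr0].
have -> : x = `|x| *: (`|x|^-1 *: x).
  by rewrite scalerA divff ?normr_eq0 // scale1r.
by apply: scale_le => //; [exact: unit_normalize|rewrite normr_id].
Qed.

(** On the diagonal, [fix_first L u] is [form_deriv] along [u] divided by the number of slots, so
    the same [M] bounds it: no constant is lost when an argument is fixed. *)
Lemma polarization_bound k (L : 'rV[H]_k -> K^o) C M :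
  multilinear_form L -> Defs.symmetric_form L -> 0 <= C -> bounded_form C L ->
  (forall x, `|x| <= 1 -> modulus (associated_poly L x) <= M) ->
  forall v : 'rV[H]_k, (forall i, `|v 0 i| <= 1) -> modulus (L v) <= M.
Proof.
elim: k L C => [|k IHk] L C L_lin L_sym C_ge0 L_le P_le v v_le.
  have -> : v = const_mx 0 by apply/rowP; case.
  by apply: P_le; rewrite normr0.
rewrite (cons_row_eta v) -/(fix_first L _ _).
set u := v 0 ord0; have u_le : `|u| <= 1 by exact: v_le.
apply: (IHk _ (C * `|u|)).
- exact: fix_first_multilinear.
- exact: symmetric_fix_first.
- exact: mulr_ge0.
- exact: fix_first_bounded.
- move=> x x_le.
  have := form_deriv_le L_lin L_sym C_ge0 L_le P_le x_le u_le.
  rewrite form_deriv_symmetric // modulusM modulus_nat.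
  by rewrite ler_pM2l ?ltr0n.
- by move=> i; rewrite mxE.
Qed.

End HilbertSpace.

Theorem theorem14 (R : realType) (s : scalars)
    (H : completeNormedModType (scalar_field R s))
    (dot : {dot H for @scalar_conj R s})
    (norm_dot : forall u : H, `|u| ^+ 2 = dot u u)
    (n : nat) (n_gt0 : (0 < n)%N) :
  [/\ forall P : H -> (scalar_field R s)^o, continuous_poly n P ->
        forall x : H, `|x| = 1 ->
        Num.sqrt (n%:R ^+ 2 * modulus (P x) ^+ 2 - modulus ('d P x x) ^+ 2
                  + sup_norm ('d P x) ^+ 2)
          <= n%:R * sup_norm P,
      forall L : 'rV[H]_n -> (scalar_field R s)^o,
        continuous_symmetric_form L ->
        diff_norm (associated_poly L) <= n%:R * sup_norm (associated_poly L)
    & forall L : 'rV[H]_n -> (scalar_field R s)^o,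
        continuous_symmetric_form L ->
        form_norm L = sup_norm (associated_poly L)].
Proof.
split.
- move=> P [Q Q_hom P_sum] x x1.
  have [L L_form Q_eq] := fin_all_exists2 Q_hom.
  have C_ex k : exists2 c, 0 <= c & bounded_form c (@L k).
    have [L_cont _ L_lin] := L_form k.
    exact: continuous_multilinear_bounded.
  have [C C_ge0 L_le] := fin_all_exists2 C_ex.
  have L_lin k : multilinear_form (@L k) by have [] := L_form k.
  have {Q_eq}P_eq u : P u = \sum_k associated_poly (@L k) u.
    by rewrite P_sum; apply: eq_bigr => k _; rewrite Q_eq.
  have deg_le (k : 'I_n.+1) : (k <= n)%N by rewrite -ltnS.
  (* A crude bound, making [sup_norm P] an upper bound of the values. *)
  pose S := modulus (\sum_k C k).
  have P_le_S u : `|u| <= 1 -> modulus (P u) <= S.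
    move=> u_le; rewrite ler_modulus of_real_modulus.
    apply: le_trans (poly_bounded C_ge0 L_le P_eq u_le) _.
    exact: real_ler_norm (ger0_real (sumr_ge0 _ (fun k _ => C_ge0 k))).
  have P_le u : `|u| <= 1 -> modulus (P u) <= sup_norm P.
    exact: modulus_le_sup_norm P_le_S.
  have M_ge0 : 0 <= sup_norm P.
    by apply: le_trans (modulus_ge0 _) (P_le 0 _); rewrite normr0.
  have dP_le := derivative_bound norm_dot n_gt0 L_lin C_ge0 L_le deg_le P_eq
    P_le x1.
  (* This bound does not depend on the direction [z], so its square root bounds the supremum over
     directions. *)
  pose B := modulus ('d P x x) ^+ 2 +
    ((n%:R * sup_norm P) ^+ 2 - (n%:R * modulus (P x)) ^+ 2).
  have dP_bd z : `|z| <= 1 -> modulus ('d P x z) <= Num.sqrt B.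
    move=> z_le.
    by rewrite -[leLHS]ger0_norm ?modulus_ge0 // -sqrtr_sqr ler_wsqrtr ?dP_le.
  have dP_sup := sup_norm_le dP_bd.
  have B_ge0 : 0 <= B.
    by apply: le_trans (dP_le 0 _); rewrite ?sqr_ge0 ?normr0.
  have sup_ge0 : 0 <= sup_norm ('d P x).
    apply: le_trans (modulus_ge0 ('d P x 0)) (modulus_le_sup_norm dP_bd _).
    by rewrite normr0.
  rewrite -[leRHS]ger0_norm ?mulr_ge0 // -sqrtr_sqr ler_wsqrtr //.
  have : sup_norm ('d P x) ^+ 2 <= B.
    by rewrite -(sqr_sqrtr B_ge0) ler_pXn2r // nnegrE sqrtr_ge0.
  by rewrite /B exprMn; lra.
- move=> L [L_cont L_sym L_lin].
  have [C C_ge0 L_le] := continuous_multilinear_bounded L_cont L_lin.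
  have P_le := modulus_le_sup_norm (associated_poly_modulus_le C_ge0 L_le).
  apply: ge_sup.
    by exists (sup_norm ('d (associated_poly L) 0)), 0 => //=; rewrite normr0.
  move=> _ [x x_le <-]; apply: sup_norm_le => h h_le.
  rewrite (diff_associated_poly L_lin C_ge0 L_le).
  exact: (form_deriv_le norm_dot L_lin L_sym C_ge0 L_le).
- move=> L [L_cont L_sym L_lin].
  have [C C_ge0 L_le] := continuous_multilinear_bounded L_cont L_lin.
  have P_le := modulus_le_sup_norm (associated_poly_modulus_le C_ge0 L_le).
  have form_le := polarization_bound norm_dot L_lin L_sym C_ge0 L_le P_le.
  apply/eqP; rewrite eq_le; apply/andP; split.
    apply: ge_sup; last by move=> _ [v v_le <-]; exact: form_le.
    by exists (modulus (L 0)), 0 => //= i; rewrite mxE normr0.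
  (* Values of the polynomial are values of [L] on constant rows. *)
  apply: sup_norm_le => x x_le; apply: ub_le_sup.
    by exists (sup_norm (associated_poly L)) => _ [v v_le <-]; exact: form_le.
  by exists (const_mx x) => //= i; rewrite mxE.
Qed.
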